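(* Let $B$ be a network with edge resistances $r_g$, and let $K$ be a network with the same underlying graph and with edge resistances $\tau_g$ satisfying $0<\tau_g\le\beta r_g$ for every edge $g$, where $0<\beta\le1$. Subdivide each edge of $B$ at a finite grid of points containing both endpoints of the edge, and let $D$ be the maximum effective resistance, in the subdivided network, between two of the resulting grid vertices. Select points $z_h,z_k$ in the interiors of two distinct edges $h,k$ of $K$, with relative coordinates $t_h,t_k\in(0,1)$ respectively. For $i\in\{h,k\}$, let $u_i,v_i$ be the endpoints of edge $i$ (with $u_i$ at relative coordinate $0$ and $v_i$ at relative coordinate $1$), choose consecutive relative grid coordinates on edge $i$ bracketing $t_i$, and let $X_i$ be the random variable taking these two values and having mean $t_i$. Put $\varepsilon_i=\operatorname{Var}(X_i)$ and $\rho_i=R_B(u_i,v_i)$, and take $X_h,X_k$ independent. Then, in the network obtained by inserting the two selected points $z_h,z_k$ into $K$, $$R(z_h,z_k)\le\beta D+C_h+C_k,$$ where $$C_i=(\tau_i-\beta r_i)\,t_i(1-t_i)+\beta(r_i-\rho_i)\,\varepsilon_i\qquad(i=h,k).$$ Thus $C_h+C_k\le(1-\beta)D$ is sufficient for $R(z_h,z_k)\le D$.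
   Context: A network is a finite connected loopless multigraph (parallel edges allowed) with positive edge resistances. $R_N(x,y)$ denotes the effective resistance between vertices $x,y$ of a network $N$, with $R_N(x,x)=0$. The relative coordinate of a point on an edge of resistance $r$ with endpoints $u,v$ is $t\in[0,1]$ when the resistance of the segment from $u$ to the point is $rt$ and that from the point to $v$ is $r(1-t)$. Inserting a point (or subdividing at a point) with relative coordinate $t\in(0,1)$ on an edge of resistance $r$ means replacing the edge by two edges in series of resistances $rt$ and $r(1-t)$ meeting at a new vertex. *)

(* Defs.v *)
From HB Require Import structures.
From mathcomp Require Import all_boot all_order all_algebra.
From mathcomp Require Import all_classical all_reals all_analysis.

Set Implicit Arguments.
Unset Strict Implicit.
Unset Printing Implicit Defensive.

Import Order.TTheory GRing.Theory Num.Theory.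
Import numFieldNormedType.Exports.

Local Open Scope classical_set_scope.
Local Open Scope ring_scope.

(* A finite multigraph.  The orientation of an edge is only a reference
   orientation: it fixes which endpoint has relative coordinate 0 ([src]) and
   which has relative coordinate 1 ([tgt]). *)
Record multigraph := Multigraph {
  vertex : finType;
  edge : finType;
  src : edge -> vertex;
  tgt : edge -> vertex }.
Arguments src {_} _.
Arguments tgt {_} _.

Definition loopless (G : multigraph) : Prop :=
  forall e : edge G, src e != tgt e.

Definition adjacent (G : multigraph) : rel (vertex G) := fun x y =>
  [exists e : edge G, ((src e == x) && (tgt e == y))
                   || ((src e == y) && (tgt e == x))].

Definition connected_graph (G : multigraph) : Prop :=
  forall x y : vertex G, connect (@adjacent G) x y.

Section Networks.
Variable R : realType.

Definition is_network (G : multigraph) (r : edge G -> R) : Prop :=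
  [/\ loopless G, connected_graph G & forall e, 0 < r e].

(* Net current flowing out of [w] into the edges at [w], by Ohm's law, when the
   vertices are held at the potentials [p]. *)
Definition net_current (G : multigraph) (r : edge G -> R)
    (p : vertex G -> R) (w : vertex G) : R :=
  \sum_(e | src e == w) (p w - p (tgt e)) / r e
  + \sum_(e | tgt e == w) (p w - p (src e)) / r e.

(* Kirchhoff's law for a unit current injected at [x] and extracted at [y]. *)
Definition unit_current_potential (G : multigraph) (r : edge G -> R)
    (x y : vertex G) (p : vertex G -> R) : Prop :=
  forall w, net_current r p w = (w == x)%:R - (w == y)%:R.

(* In a network such a potential exists and is unique up to an additive
   constant, so the drop below does not depend on the potential chosen. *)
Definition effres (G : multigraph) (r : edge G -> R) (x y : vertex G) : R :=
  let p : {ffun vertex G -> R} :=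
    xget 0 [set p : {ffun vertex G -> R} | unit_current_potential r x y p] in
  p x - p y.

(* The points at which an edge is subdivided are given by the list [s] of their
   relative coordinates in (0,1); [grid s] adds the two endpoints. *)
Definition grid (s : seq R) : seq R := 0 :: rcons s 1.

Definition is_grid (s : seq R) : bool := sorted <%R (grid s).

Section Subdivision.
Variables (G : multigraph) (s : edge G -> seq R).

Definition sub_vertex : finType :=
  (vertex G + {g : edge G & 'I_(size (s g))})%type.

Definition sub_edge : finType := {g : edge G & 'I_(size (s g)).+1}.

(* The vertex at position [j] in [grid (s g)], for [j <= (size (s g)).+1]. *)
Definition grid_vertex (g : edge G) (j : nat) : sub_vertex :=
  if j is j'.+1 then
    if insub j' is Some i
    then inr (Tagged (fun g => 'I_(size (s g))) (i : 'I_(size (s g))))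
    else inl (tgt g)
  else inl (src g).

Definition subdivide : multigraph := @Multigraph sub_vertex sub_edge
  (fun e => grid_vertex (tag e) (tagged e))
  (fun e => grid_vertex (tag e) (tagged e).+1).

Definition subdivide_res (r : edge G -> R) (e : edge subdivide) : R :=
  r (tag e) * ((grid (s (tag e)))`_(tagged e).+1
               - (grid (s (tag e)))`_(tagged e)).

(* The vertex of the subdivision at relative coordinate [t] on the edge [g]
   of [G], for [t] in [grid (s g)]. *)
Definition point_at (g : edge G) (t : R) : vertex subdivide :=
  grid_vertex g (index t (grid (s g))).

Definition max_grid_effres (r : edge G -> R) : R :=
  \big[Num.max/0]_(g : edge G) \big[Num.max/0]_(t <- grid (s g))
  \big[Num.max/0]_(g' : edge G) \big[Num.max/0]_(t' <- grid (s g'))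
    effres (subdivide_res r) (point_at g t) (point_at g' t').

End Subdivision.

(* Subdivision points for inserting one point of relative coordinate [th] on
   the edge [h] and one of relative coordinate [tk] on the edge [k != h]. *)
Definition two_points (G : multigraph) (h k : edge G) (th tk : R)
    (g : edge G) : seq R :=
  if g == h then [:: th] else if g == k then [:: tk] else [::].

End Networks.

Definition independent_RV d (T : measurableType d) (R : realType)
    (P : probability T R) (X Y : {RV P >-> R}) : Prop :=
  forall A B : set R, measurable A -> measurable B ->
    (P ((X @^-1` A) `&` (Y @^-1` B)) = P (X @^-1` A) * P (Y @^-1` B))%E.

(* Main.v *)
Require Import Defs.
From HB Require Import structures.
From mathcomp Require Import all_boot all_order all_algebra.
From mathcomp Require Import ring lra.
From mathcomp Require Import all_classical all_reals all_analysis.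

(** The first ingredient compares the two networks by Thomson's principle: among
    all unit flows from [x] to [y], the electrical one has the least energy, and
    that energy is the effective resistance ([effres_energy], [thomson]).  Insert
    the points [z_h] and [z_k] into both [B] and [K], and use the electrical flow
    of [B] as a competitor in [K].  Replacing [beta * r_g] by the smaller
    [tau_g] can only lower the energy spent on the edge [g].  On [h] the gain is
    quantified: the flow jumps by one at [z_h], and a flow with a unit jump at
    relative coordinate [t] has mean square at least [t * (1 - t)]
    ([sum_gap_sqr]).  The same holds on [k], which gives [effres_comparison]:
    [R_K <= beta * R_B + sum_i (tau_i - beta * r_i) * t_i * (1 - t_i)], where
    [R_K] and [R_B] are taken between [z_h] and [z_k].

    The second ingredient bounds [R_B].  Seen from the vertices of [B], a unit
    current entering [h] at relative coordinate [a] is a current [1 - a] entering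
    at one end and [a] at the other; inside [h] it adds to the linear
    interpolation of the potential the Green function of an interval.  So an
    explicit potential of the subdivided network comes from a potential of
    [B] itself, and the resistance between the points [a] of [h] and [b] of [k]
    does not depend on the grid: it is bilinear in [(a, b)] apart from the terms
    [- (r_h - rho_h) * a ^ 2] and [- (r_k - rho_k) * b ^ 2]
    ([effres_quadratic]).

    Averaging this function over two-point distributions on the bracketing grid
    coordinates, with means [t_h] and [t_k], keeps the bilinear part and replaces
    [t_i ^ 2] by [t_i ^ 2 + eps_i].  The averaged values are grid resistances, at
    most [D], so [R_B <= D + sum_i (r_i - rho_i) * eps_i]
    ([quadratic_average]).  Combining the two estimates gives the bound.  The
    random variables enter through [eps_i = (b_i - t_i) * (t_i - a_i)]
    ([two_point_variance]). *)

Set Implicit Arguments.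
Unset Strict Implicit.
Unset Printing Implicit Defensive.

Import Order.TTheory GRing.Theory Num.Theory.
Import numFieldNormedType.Exports.

Local Open Scope classical_set_scope.
Local Open Scope ring_scope.

(** * Flows, potentials and Thomson's principle *)

Lemma connected_constant (G : multigraph) (A : Type) (p : vertex G -> A) :
  connected_graph G -> (forall e : edge G, p (src e) = p (tgt e)) ->
  forall x y, p x = p y.
Proof.
move=> conn pE x y; case/connectP: (conn x y) => s + ->.
elim: s x => //= z s IHs x /andP[/existsP[e xz] /IHs <-].
by case/orP: xz => /andP[/eqP<- /eqP<-].
Qed.

Section Flows.
Variables (R : realType) (G : multigraph).
Implicit Types (r f : edge G -> R) (p : vertex G -> R) (x y w : vertex G).

Definition divergence f w : R :=
  \sum_e f e * ((src e == w)%:R - (tgt e == w)%:R).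

Definition ohm r p (e : edge G) : R := (p (src e) - p (tgt e)) / r e.

Definition unit_flow x y f : Prop :=
  forall w, divergence f w = (w == x)%:R - (w == y)%:R.

Lemma net_current_divergence r p w :
  net_current r p w = divergence (ohm r p) w.
Proof.
rewrite /net_current /divergence big_mkcond [X in _ + X]big_mkcond /=.
rewrite -big_split /=; apply: eq_bigr => e _; rewrite /ohm.
by case: eqP => [<-|_]; case: eqP => [<-|_] /=; ring.
Qed.

Lemma divergenceB f1 f2 w :
  divergence (fun e => f1 e - f2 e) w = divergence f1 w - divergence f2 w.
Proof. by rewrite -sumrB; apply: eq_bigr => e _; ring. Qed.

(** Summation by parts: taking potential drops and taking divergences are
    adjoint operations. *)
Lemma sum_drop_flow p f :
  \sum_e (p (src e) - p (tgt e)) * f e = \sum_w p w * divergence f w.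
Proof.
under [RHS]eq_bigr do rewrite mulr_sumr.
rewrite exchange_big /=; apply: eq_bigr => e _.
have pick v : \sum_w p w * (v == w)%:R = p v :> R.
  rewrite (bigD1 v) //= eqxx mulr1 big1 ?addr0 // => w /negPf wv.
  by rewrite eq_sym wv mulr0.
rewrite -(pick (src e)) -(pick (tgt e)) -sumrB mulr_suml.
by apply: eq_bigr => w _; ring.
Qed.

Lemma sum_divergence f : \sum_w divergence f w = 0.
Proof.
transitivity (\sum_w 1 * divergence f w).
  by apply: eq_bigr => w _; rewrite mul1r.
rewrite -(sum_drop_flow (fun=> 1)) big1 // => e _.
by rewrite subrr mul0r.
Qed.

Lemma sum_mul_unit p x y :
  \sum_w p w * ((w == x)%:R - (w == y)%:R) = p x - p y.
Proof.
have pick v : \sum_w p w * (w == v)%:R = p v :> R.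
  rewrite (bigD1 v) //= eqxx mulr1 big1 ?addr0 // => w /negPf ->.
  by rewrite mulr0.
by rewrite -(pick x) -(pick y) -sumrB; apply: eq_bigr => w _; ring.
Qed.

Section Network.
Variable r : edge G -> R.
Hypothesis netG : is_network r.

Let r_gt0 e : 0 < r e. Proof. by case: netG. Qed.

(** A potential driving no net current anywhere has zero energy, so it cannot
    drop across any edge. *)
Lemma harmonic_constant p :
  (forall w, net_current r p w = 0) -> forall x y, p x = p y.
Proof.
case: netG => _ conn _ p0; apply: connected_constant conn _ => e.
have : \sum_e (p (src e) - p (tgt e)) * ohm r p e = 0.
  rewrite sum_drop_flow big1 // => w _.
  by rewrite -net_current_divergence p0 mulr0.
have ge0 e' : 0 <= (p (src e') - p (tgt e')) * ohm r p e'.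
  by rewrite /ohm mulrA -expr2 divr_ge0 ?sqr_ge0 ?ltW.
move/eqP; rewrite psumr_eq0 // => /allP/(_ e (mem_index_enum _)).
rewrite /ohm mulrA -expr2 mulf_eq0 invr_eq0 (gt_eqF (r_gt0 e)) orbF.
by rewrite sqrf_eq0 subr_eq0 => /eqP.
Qed.

Lemma unit_flow_ohm x y p :
  unit_current_potential r x y p -> unit_flow x y (ohm r p).
Proof. by move=> pP w; rewrite -net_current_divergence. Qed.

(** Two potentials of the same unit current differ by a harmonic function, that
    is, by a constant, so any of them computes the resistance. *)
Lemma effresE x y p :
  unit_current_potential r x y p -> effres r x y = p x - p y.
Proof.
move=> pP; rewrite /effres.
case: xgetP => [q _ /= qP|]; last first.
  move=> /(_ [ffun w => p w]) []; rewrite /= => w; rewrite -pP.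
  by rewrite /net_current; congr (_ + _); apply: eq_bigr => e _; rewrite !ffunE.
have h0 w : net_current r (fun v => q v - p v) w = 0.
  rewrite net_current_divergence.
  transitivity (divergence (fun e => ohm r q e - ohm r p e) w).
    by apply: eq_bigr => e _; rewrite /ohm; ring.
  by rewrite divergenceB -!net_current_divergence qP pP subrr.
have := harmonic_constant h0 x y; lra.
Qed.

Lemma effres_energy x y p :
  unit_current_potential r x y p ->
  effres r x y = \sum_e r e * ohm r p e ^+ 2.
Proof.
move=> pP; rewrite (effresE pP) -sum_mul_unit.
under eq_bigr do rewrite -(unit_flow_ohm pP).
rewrite -sum_drop_flow; apply: eq_bigr => e _.
by rewrite /ohm; field; rewrite gt_eqF.
Qed.

(** The Laplacian has the constants as kernel.  Adding to it the total mass of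
    the potential makes it injective, hence surjective; and a preimage of a
    function of total 0 has total mass 0, because net currents add up to 0. *)
Lemma unit_potential_exists x y :
  exists p, unit_current_potential r x y p.
Proof.
pose L (p : {ffun vertex G -> R^o}) : {ffun vertex G -> R^o} :=
  [ffun w => net_current r p w + \sum_v (p v : R)].
have linL : linear L.
  move=> a p q; apply/ffunP => w; rewrite !ffunE /= !net_current_divergence.
  rewrite scalerDr addrACA /divergence /= !scaler_sumr -!big_split /=.
  congr (_ + _); apply: eq_bigr => e _; rewrite /ohm !ffunE //.
  by rewrite /GRing.scale /=; ring.
(* Packing [L] with its linearity gives access to kernels and images. *)
pose Lm := GRing.isLinear.Build R _ _ _ L linL.
pose LL : {linear {ffun vertex G -> R^o} -> {ffun vertex G -> R^o}} :=
  HB.pack L Lm.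
have nz : #|vertex G|%:R != 0 :> R.
  by rewrite pnatr_eq0 -lt0n; apply/card_gt0P; exists x.
have sumL (p : {ffun vertex G -> R^o}) :
    \sum_w (L p w : R) = (\sum_v (p v : R)) * #|vertex G|%:R.
  under eq_bigr do rewrite ffunE net_current_divergence.
  by rewrite big_split /= sum_divergence add0r sumr_const mulr_natr.
have inj : lker (linfun LL) == 0%VS.
  apply/lker0P => p q; rewrite !lfunE /= => Lpq.
  have /(congr1 (fun g : {ffun vertex G -> R^o} => \sum_w (g w : R))) := Lpq.
  rewrite !sumL => /(mulIf nz) spq.
  have h0 w : net_current r (fun v => p v - q v) w = 0.
    rewrite net_current_divergence.
    transitivity (divergence (fun e => ohm r p e - ohm r q e) w).
      by apply: eq_bigr => e _; rewrite /ohm; ring.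
    rewrite divergenceB -!net_current_divergence.
    by move/ffunP/(_ w): Lpq; rewrite !ffunE spq => /addIr ->; rewrite subrr.
  apply/ffunP => w; apply/eqP; rewrite -subr_eq0 -(mulIr_eq0 _ (mulIf nz)).
  rewrite mulr_natr -sumr_const.
  rewrite (eq_bigr (fun v => p v - q v)); last first.
    by move=> v _; exact: (harmonic_constant h0 w v).
  by rewrite sumrB spq subrr.
have := memvf ([ffun w => (w == x)%:R - (w == y)%:R] : {ffun vertex G -> R^o}).
rewrite -(lker0_limgf inj) => /memv_imgP[p _]; rewrite lfunE /= => pE.
have s0 : \sum_v (p v : R) = 0.
  apply: (mulIf nz); rewrite -sumL -pE mul0r.
  transitivity (\sum_w 1 * ((w == x)%:R - (w == y)%:R) : R).
    by apply: eq_bigr => w _; rewrite ffunE mul1r.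
  by rewrite sum_mul_unit subrr.
exists p => w; move/ffunP/(_ w): pE; rewrite !ffunE => ->.
by rewrite s0 addr0.
Qed.

(** With [g] the electrical flow, [f ^ 2 >= 2 * g * f - g ^ 2] on every edge;
    summing with weights [r], both [r * g * f] and [r * g ^ 2] add up to the
    potential drop between [x] and [y]. *)
Lemma thomson x y f :
  unit_flow x y f -> effres r x y <= \sum_e r e * f e ^+ 2.
Proof.
move=> fP; have [p pP] := unit_potential_exists x y.
 rewrite (effresE pP).
have drop g : unit_flow x y g ->
    \sum_e (p (src e) - p (tgt e)) * g e = p x - p y.
  move=> gP; rewrite sum_drop_flow -[RHS]sum_mul_unit.
  by apply: eq_bigr => w _; rewrite gP.
have -> : p x - p y = 2 * (p x - p y) - (p x - p y) by ring.
rewrite -{1}(drop f fP) -(drop _ (unit_flow_ohm pP)) mulr_sumr -sumrB.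
apply: ler_sum => e _.
have -> : p (src e) - p (tgt e) = r e * ohm r p e.
  by rewrite /ohm mulrC divfK ?gt_eqF.
have := mulr_ge0 (ltW (r_gt0 e)) (sqr_ge0 (f e - ohm r p e)); lra.
Qed.

End Network.
End Flows.

(** * Grids on the unit interval *)

Section Grids.
Variable R : realType.
Implicit Types (t : seq R) (a c : R).

Lemma grid0 t : (grid t)`_0 = 0. Proof. by []. Qed.

Lemma grid_last t : (grid t)`_(size t).+1 = 1.
Proof. by rewrite /= nth_rcons ltnn eqxx. Qed.

Lemma size_grid t : size (grid t) = (size t).+2.
Proof. by rewrite /= size_rcons. Qed.

Lemma grid_lt t i j : is_grid t -> (i < j < (size t).+2)%N ->
  (grid t)`_i < (grid t)`_j.
Proof.
move=> tP /andP[ij jn].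
by rewrite (sorted_ltn_nth lt_trans) ?inE ?size_grid // (ltn_trans ij).
Qed.

Lemma grid_le t i j : is_grid t -> (i <= j < (size t).+2)%N ->
  (grid t)`_i <= (grid t)`_j.
Proof.
move=> tP /andP[]; rewrite leq_eqVlt => /predU1P[->//|ij jn].
by rewrite ltW // grid_lt ?ij.
Qed.

Lemma index_grid t a : a \in grid t -> (index a (grid t) < (size t).+2)%N.
Proof. by rewrite -index_mem size_grid. Qed.

Lemma grid_itv t a : is_grid t -> a \in grid t -> 0 <= a <= 1.
Proof.
move=> tP ta; have := index_grid ta; rewrite ltnS => le_a.
rewrite -(nth_index 0 ta); apply/andP; split.
  by rewrite -[leLHS](grid0 t) grid_le // ltnS le_a.
by rewrite -[leRHS](grid_last t) grid_le // le_a /=.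
Qed.

Lemma sum_prefix_gaps (V : zmodType) (u : nat -> V) n m : (m <= n)%N ->
  \sum_(0 <= j < n | (j < m)%N) (u j.+1 - u j) = u m - u 0%N.
Proof.
move=> mn; rewrite -(telescope_sumr u (leq0n m)) (big_cat_nat (n := m)) //=.
rewrite [X in _ + X]big_nat_cond [X in _ + X]big_pred0; last first.
  by move=> j; apply/negP => /andP[/andP[mj _]]; rewrite ltnNge mj.
rewrite addr0 big_nat_cond [RHS]big_nat_cond; apply: eq_bigl => j.
by case: (j < m)%N; rewrite ?andbF.
Qed.

(** The Green function of the interval [0, 1] with grounded ends: its slope drops
    by one at [a]. *)
Definition tent a c : R := Num.min a c - a * c.

Lemma tent0 a : 0 <= a -> tent a 0 = 0.
Proof. by move=> a0; rewrite /tent min_r // mulr0 subrr. Qed.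

Lemma tent1 a : a <= 1 -> tent a 1 = 0.
Proof. by move=> a1; rewrite /tent min_l // mulr1 subrr. Qed.

Lemma tent_drop t a j : is_grid t -> a \in grid t -> (j < (size t).+1)%N ->
  tent a (grid t)`_j - tent a (grid t)`_j.+1
  = ((grid t)`_j.+1 - (grid t)`_j) * (a - (j < index a (grid t))%:R).
Proof.
move=> tP ta jn; rewrite /tent; have an := index_grid ta.
have jj : (grid t)`_j <= (grid t)`_j.+1 by rewrite grid_le // leqnSn.
case: ltnP => [ja|aj].
  have ja' : (grid t)`_j.+1 <= a by rewrite -(nth_index 0 ta) grid_le // ja.
  by rewrite !min_r ?(le_trans jj) //=; ring.
have ja' : a <= (grid t)`_j.
  by rewrite -(nth_index 0 ta) grid_le // aj /= ltnW.
by rewrite !min_l ?(le_trans ja') //=; ring.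
Qed.

(** The left-hand side is the mean square of the step function equal to [c - 1]
    before [a] and to [c] after it: its squared mean plus the variance of a
    Bernoulli variable. *)
Lemma sum_gap_sqr t a c : is_grid t -> a \in grid t ->
  \sum_(0 <= j < (size t).+1) ((grid t)`_j.+1 - (grid t)`_j)
     * (c - (j < index a (grid t))%:R) ^+ 2
  = (c - a) ^+ 2 + a * (1 - a).
Proof.
move=> tP ta; set u := fun j => (grid t)`_j.
have sumT : \sum_(0 <= j < (size t).+1) (u j.+1 - u j) = 1.
  by rewrite telescope_sumr // /u grid_last grid0 subr0.
have sumA : \sum_(0 <= j < (size t).+1 | (j < index a (grid t))%N)
    (u j.+1 - u j) = a.
  rewrite sum_prefix_gaps; last exact: index_grid.
  by rewrite [u _]nth_index // [u 0%N]grid0 subr0.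
transitivity (c ^+ 2 * (\sum_(0 <= j < (size t).+1) (u j.+1 - u j))
  + (1 - 2 * c) * (\sum_(0 <= j < (size t).+1 | (j < index a (grid t))%N)
                    (u j.+1 - u j))); last by rewrite sumT sumA; ring.
rewrite [X in _ = _ + _ * X]big_mkcond !mulr_sumr -big_split.
by apply: eq_bigr => j _; rewrite /u; case: ltnP => _ /=; ring.
Qed.

End Grids.

(** * Subdivided networks *)

Section Subdivided.
Variables (R : realType) (G : multigraph) (s : edge G -> seq R).
Hypothesis s_grid : forall g, is_grid (s g).

Local Notation coord g j := ((grid (s g))`_j).
Local Notation gv := (grid_vertex s).

(** Indexing the pieces of an edge by natural numbers makes telescoping sums
    available and keeps dependent types out of the later computations. *)
Lemma sum_sub_edge (F : edge G -> nat -> R) :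
  \sum_(e : sub_edge s) F (tag e) (tagged e)
  = \sum_g \sum_(0 <= j < (size (s g)).+1) F g j.
Proof.
under [RHS]eq_bigr do rewrite big_mkord.
by rewrite (sig_big_dep _ _ (fun g (j : 'I_(size (s g)).+1) => F g j)).
Qed.

Lemma grid_vertex_last g : gv g (size (s g)).+1 = inl (tgt g).
Proof. by rewrite /= insubF // ltnn. Qed.

Lemma grid_vertex_inner g (i : 'I_(size (s g))) :
  gv g i.+1 = inr (Tagged (fun g => 'I_(size (s g))) i).
Proof. by rewrite /= valK. Qed.

(** Every grid vertex is joined to the first endpoint of its edge, so the
    component of an endpoint is constant across the edges of [G]. *)
Lemma connected_subdivide : connected_graph G -> connected_graph (subdivide s).
Proof.
move=> conn.
have adjC : symmetric (@Defs.adjacent (subdivide s)).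
  by move=> x y; apply: eq_existsb => e; rewrite orbC.
have stepP g j : (j < (size (s g)).+1)%N ->
    connect (@Defs.adjacent (subdivide s)) (gv g j) (gv g j.+1).
  move=> jn; apply/connect1/existsP.
  exists (Tagged (fun g => 'I_(size (s g)).+1) (Ordinal jn)).
  by rewrite /= !eqxx.
have along g j : (j <= (size (s g)).+1)%N ->
    connect (@Defs.adjacent (subdivide s)) (inl (src g)) (gv g j).
  elim: j => [|j IHj] jn; first exact: connect0.
  exact: connect_trans (IHj (ltnW jn)) (stepP _ _ jn).
have cC := sym_connect_sym adjC.
have rootE g j : (j <= (size (s g)).+1)%N ->
    fingraph.root (@Defs.adjacent (subdivide s)) (gv g j)
    = fingraph.root (@Defs.adjacent (subdivide s)) (inl (src g)).
  by move=> /along/(fingraph.rootP cC).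
pose rt x := fingraph.root (@Defs.adjacent (subdivide s)) (inl x).
have rtE x y : rt x = rt y.
  apply: (connected_constant conn) => g.
  by rewrite /rt -(rootE g (size (s g)).+1) // grid_vertex_last.
have rootV (v : vertex (subdivide s)) :
    exists x, fingraph.root (@Defs.adjacent (subdivide s)) v = rt x.
  case: v => [x|[g i]]; first by exists x.
  by exists (src g); rewrite -(grid_vertex_inner i) rootE // ltnW // ltnS.
move=> v w; apply/(fingraph.rootP cC).
by have [x ->] := rootV v; have [y ->] := rootV w.
Qed.

Lemma subdivide_network (r : edge G -> R) :
  is_network r -> is_network (subdivide_res (s := s) r).
Proof.
case=> noloop conn r_gt0; split; first last.
- move=> [g j] /=; rewrite mulr_gt0 // subr_gt0.
  by apply: grid_lt => //; rewrite leqnn ltnS ltn_ord.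
- exact: connected_subdivide.
move=> [g [[|j] jn]]; apply/eqP; rewrite /= /grid_vertex /=.
- case: insubP => [//|_] [] /eqP; exact/negP/noloop.
- rewrite (insubT (fun i => i < size (s g))%N jn).
  case: insubP => [i _ iE|//] [] /eqP.
  rewrite eq_Tagged /= => /eqP ji.
  by move: iE; rewrite -ji /= => /n_Sn.
Qed.

Lemma divergence_subdivide (F : edge G -> nat -> R) (w : vertex (subdivide s)) :
  divergence (fun e : edge (subdivide s) => F (tag e) (tagged e)) w
  = \sum_g \sum_(0 <= j < (size (s g)).+1)
      F g j * ((gv g j == w)%:R - (gv g j.+1 == w)%:R).
Proof.
exact: (sum_sub_edge
  (fun g j => F g j * ((gv g j == w)%:R - (gv g j.+1 == w)%:R))).
Qed.

Lemma sum_edge_cut g w :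
  \sum_(0 <= j < (size (s g)).+1) ((gv g j == w)%:R - (gv g j.+1 == w)%:R)
  = (inl (src g) == w)%:R - (inl (tgt g) == w)%:R :> R.
Proof.
have := telescope_sumr (fun j => - (gv g j == w)%:R : R) (leq0n (size (s g)).+1).
rewrite grid_vertex_last /= opprK [RHS in _ = RHS]addrC => <-.
by apply: eq_bigr => j _; rewrite opprK addrC.
Qed.

(** The current [c - 1] before the grid point [a] and [c] after it is balanced
    at every other interior grid point: a unit enters at [a], and the rest at the
    two ends of the edge. *)
Lemma sum_edge_flow g a c w : a \in grid (s g) ->
  \sum_(0 <= j < (size (s g)).+1) (c - (j < index a (grid (s g)))%:R)
      * ((gv g j == w)%:R - (gv g j.+1 == w)%:R)
  = (c - 1) * (inl (src g) == w)%:R - c * (inl (tgt g) == w)%:R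
    + (point_at s g a == w)%:R :> R.
Proof.
move=> sa; pose u j : R := - (gv g j == w)%:R.
have sumA : \sum_(0 <= j < (size (s g)).+1 | (j < index a (grid (s g)))%N)
    (u j.+1 - u j) = (inl (src g) == w)%:R - (point_at s g a == w)%:R.
  rewrite sum_prefix_gaps; last exact: index_grid.
  by rewrite /u /= opprK addrC.
transitivity (c * ((inl (src g) == w)%:R - (inl (tgt g) == w)%:R)
    - ((inl (src g) == w)%:R - (point_at s g a == w)%:R)); last by ring.
rewrite -sum_edge_cut -sumA [X in _ - X]big_mkcond /= mulr_sumr -sumrB.
by apply: eq_bigr => j _; rewrite /u; case: ltnP => _ /=; ring.
Qed.

End Subdivided.

(** * Two points on distinct edges *)

Section TwoPoints.
Variables (R : realType) (G : multigraph) (h k : edge G).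
Hypothesis hk : h != k.
Implicit Types (r tau : edge G -> R) (p : vertex G -> R) (s : edge G -> seq R).

(** The current that comes out at the two ends of [g], held at potential 0, when a
    unit current enters [g] at relative coordinate [t]. *)
Definition split_mass (g : edge G) (t : R) (w : vertex G) : R :=
  (1 - t) * (src g == w)%:R + t * (tgt g == w)%:R.

Definition split_current r p a b : Prop :=
  forall w, net_current r p w = split_mass h a w - split_mass k b w.

(** The split current depends affinely on [(a, b)]: moving [a] along [h] amounts
    to adding a current through the ends of [h], and likewise on [k].  This
    explicit dependence is what makes the resistance quadratic in [(a, b)]. *)
Lemma superposed_split_current r p0 ph pk a b :
  unit_current_potential r (src h) (src k) p0 ->
  unit_current_potential r (src h) (tgt h) ph ->
  unit_current_potential r (src k) (tgt k) pk ->
  split_current r (fun v => p0 v - a * ph v + b * pk v) a b.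
Proof.
move=> P0 Ph Pk w; rewrite net_current_divergence /split_mass.
rewrite ![_ == w]eq_sym.
transitivity (divergence (ohm r p0) w - a * divergence (ohm r ph) w
              + b * divergence (ohm r pk) w).
  rewrite /divergence !mulr_sumr -sumrB -big_split /=.
  by apply: eq_bigr => e _; rewrite /ohm; ring.
by rewrite -!net_current_divergence P0 Ph Pk; ring.
Qed.

Lemma split_current_exists r a b :
  is_network r -> exists p, split_current r p a b.
Proof.
move=> netB.
have [p0 P0] := unit_potential_exists netB (src h) (src k).
have [ph Ph] := unit_potential_exists netB (src h) (tgt h).
have [pk Pk] := unit_potential_exists netB (src k) (tgt k).
by eexists; exact: superposed_split_current P0 Ph Pk.
Qed.

(** Linear interpolation of [p] along [g], corrected by the potential created by
    the unit current entering [h] at [a] and leaving [k] at [b]. *)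
Definition edge_potential r p a b (g : edge G) (c : R) : R :=
  (1 - c) * p (src g) + c * p (tgt g)
  + (g == h)%:R * (r h * tent a c) - (g == k)%:R * (r k * tent b c).

Definition sub_potential s r p a b (v : vertex (subdivide s)) : R :=
  match v with
  | inl x => p x
  | inr (existT g i) => edge_potential r p a b g (grid (s g))`_i.+1
  end.

(** The electrical flow on the pieces of [g]: a jump by [1] at [a] on [h] and by
    [- 1] at [b] on [k]. *)
Definition sub_flow s r p a b (g : edge G) (j : nat) : R :=
  ohm r p g + (g == h)%:R * (a - (j < index a (grid (s h)))%:R)
            - (g == k)%:R * (b - (j < index b (grid (s k)))%:R).

Section Grid.
Variables (s : edge G -> seq R) (a b : R).
Hypotheses (s_grid : forall g, is_grid (s g)).
Hypotheses (ha : a \in grid (s h)) (kb : b \in grid (s k)).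

Lemma sub_potential_grid r p g j : (j < (size (s g)).+2)%N ->
  sub_potential (s := s) r p a b (grid_vertex s g j)
  = edge_potential r p a b g (grid (s g))`_j.
Proof.
have /andP[a0 a1] := grid_itv (s_grid h) ha.
have /andP[b0 b1] := grid_itv (s_grid k) kb.
case: j => [_|j].
  by rewrite /= /edge_potential !tent0 //; ring.
rewrite ltnS leq_eqVlt => /predU1P[[->]|].
  by rewrite grid_vertex_last grid_last /= /edge_potential !tent1 //; ring.
rewrite ltnS => jn.
by rewrite (grid_vertex_inner (Ordinal jn)).
Qed.

Lemma ohm_sub_potential r p (r_gt0 : forall g, 0 < r g)
    (e : edge (subdivide s)) :
  ohm (subdivide_res r) (sub_potential (s := s) r p a b) e
  = sub_flow s r p a b (tag e) (tagged e).
Proof.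
case: e => g j; set c := (grid (s g))`_j; set c' := (grid (s g))`_j.+1.
have jn : (j < (size (s g)).+1)%N by exact: ltn_ord.
transitivity ((edge_potential r p a b g c - edge_potential r p a b g c')
              / (r g * (c' - c))).
  by rewrite -!sub_potential_grid // ltnW.
have c_lt : c < c' by apply: grid_lt => //; rewrite leqnn ltnS jn.
have -> : edge_potential r p a b g c - edge_potential r p a b g c'
  = (c' - c) * (p (src g) - p (tgt g))
    + (g == h)%:R * (r h * (tent a c - tent a c'))
    - (g == k)%:R * (r k * (tent b c - tent b c')).
  by rewrite /edge_potential; ring.
have nz : c' - c != 0 by rewrite subr_eq0 gt_eqF.
have rg : r g != 0 by rewrite gt_eqF.
rewrite /sub_flow /ohm /=.
case: (eqVneq g h) => [gh|_]; case: (eqVneq g k) => [gk|_].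
- by case/eqP: hk; rewrite -gh.
- subst g; rewrite (tent_drop (s_grid h) ha jn) -/c -/c' /=.
  by field; apply/andP; split.
- subst g; rewrite (tent_drop (s_grid k) kb jn) -/c -/c' /=.
  by field; apply/andP; split.
- by rewrite /=; field; apply/andP; split.
Qed.

Lemma sub_flow_unit r p : split_current r p a b ->
  unit_flow (point_at s h a) (point_at s k b)
    (fun e : edge (subdivide s) => sub_flow s r p a b (tag e) (tagged e)).
Proof.
move=> pP w; rewrite divergence_subdivide.
pose cut g j : R := (grid_vertex s g j == w)%:R - (grid_vertex s g j.+1 == w)%:R.
pose step g c j : R := c - (j < index c (grid (s g)))%:R.
have pick g0 (X : edge G -> R) : \sum_g (g == g0)%:R * X g = X g0.
  rewrite (bigD1 g0) //= eqxx mul1r big1 ?addr0 // => g /negPf ->.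
  by rewrite mul0r.
transitivity (\sum_g ohm r p g * (\sum_(0 <= j < (size (s g)).+1) cut g j)
  + \sum_g (g == h)%:R * (\sum_(0 <= j < (size (s g)).+1) step h a j * cut g j)
  - \sum_g (g == k)%:R *
      (\sum_(0 <= j < (size (s g)).+1) step k b j * cut g j)).
  rewrite -big_split -sumrB; apply: eq_bigr => g _ /=.
  rewrite !mulr_sumr -big_split -sumrB; apply: eq_bigr => j _ /=.
  by rewrite /sub_flow /step /cut; ring.
rewrite !pick !sum_edge_flow // ![w == _]eq_sym.
under eq_bigr do rewrite sum_edge_cut.
case: w {cut} => [x|v]; last by rewrite big1 => [|g _]; rewrite /=; ring.
have /= := pP x; rewrite net_current_divergence /divergence /split_mass => ->.
by rewrite /=; ring.
Qed.

Lemma sub_potential_unit r p : is_network r -> split_current r p a b ->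
  unit_current_potential (subdivide_res r) (point_at s h a) (point_at s k b)
    (sub_potential (s := s) r p a b).
Proof.
move=> [_ _ r_gt0] pP w; rewrite net_current_divergence -(sub_flow_unit pP).
by apply: eq_bigr => e _; rewrite ohm_sub_potential.
Qed.

Lemma effres_points r p : is_network r -> split_current r p a b ->
  effres (subdivide_res r) (point_at s h a) (point_at s k b)
  = ((1 - a) * p (src h) + a * p (tgt h) + r h * (a * (1 - a)))
    - ((1 - b) * p (src k) + b * p (tgt k) - r k * (b * (1 - b))).
Proof.
move=> netB pP; have netS := subdivide_network s_grid netB.
rewrite (effresE netS (sub_potential_unit netB pP)) /point_at.
rewrite !sub_potential_grid ?index_grid // !nth_index //.
rewrite /edge_potential /tent !eqxx [k == h]eq_sym (negPf hk) !minxx /=.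
by ring.
Qed.

(** The electrical flow of the network [r], used as a competitor in the network
    [tau].  Its energy is a sum of one term per edge of [G], linear in the edge
    resistance, with nonnegative coefficients that are at least [a * (1 - a)] on
    [h] and [b * (1 - b)] on [k]; they multiply the negative or zero differences
    [tau g - beta * r g]. *)
Lemma effres_comparison r tau beta :
  is_network r -> is_network tau -> (forall g, tau g <= beta * r g) ->
  effres (subdivide_res tau) (point_at s h a) (point_at s k b)
  <= beta * effres (subdivide_res r) (point_at s h a) (point_at s k b)
     + (tau h - beta * r h) * (a * (1 - a))
     + (tau k - beta * r k) * (b * (1 - b)).
Proof.
move=> netB netK tau_le; have [p pP] := split_current_exists a b netB.
have netBs := subdivide_network s_grid netB.
have netKs := subdivide_network s_grid netK.
have [_ _ r_gt0] := netB.
pose F := sub_flow s r p a b.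
pose gap g j := (grid (s g))`_j.+1 - (grid (s g))`_j.
(* [S g] is the mean square of the flow along the edge [g]. *)
pose S g := \sum_(0 <= j < (size (s g)).+1) gap g j * F g j ^+ 2.
have energyE (rho : edge G -> R) :
    \sum_(e : edge (subdivide s)) subdivide_res rho e
      * F (tag e) (tagged e) ^+ 2 = \sum_g rho g * S g.
  rewrite (sum_sub_edge s (fun g j => rho g * gap g j * F g j ^+ 2)).
  by apply: eq_bigr => g _; rewrite mulr_sumr; apply: eq_bigr => j _; ring.
have S_ge0 g : 0 <= S g.
  rewrite /S big_nat_cond sumr_ge0 // => j /andP[/andP[_ jn] _].
  by rewrite mulr_ge0 ?sqr_ge0 // subr_ge0 grid_le // leqnSn ltnS.
have S_h : a * (1 - a) <= S h.
  rewrite (_ : S h = (ohm r p h + a - a) ^+ 2 + a * (1 - a)) ?lerDr ?sqr_ge0 //.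
  rewrite -(sum_gap_sqr _ (s_grid h) ha); apply: eq_bigr => j _.
  by rewrite /F /sub_flow eqxx (negPf hk) /gap /=; ring.
have S_k : b * (1 - b) <= S k.
  rewrite (_ : S k = (b - ohm r p k - b) ^+ 2 + b * (1 - b)) ?lerDr ?sqr_ge0 //.
  rewrite -(sum_gap_sqr _ (s_grid k) kb); apply: eq_bigr => j _.
  by rewrite /F /sub_flow eqxx [k == h]eq_sym (negPf hk) /gap /=; ring.
have := thomson netKs (sub_flow_unit pP); rewrite (energyE tau).
move=> /le_trans; apply.
rewrite (effres_energy netBs (sub_potential_unit netB pP)).
under [X in _ <= _ * X + _ + _]eq_bigr do rewrite ohm_sub_potential //.
rewrite (energyE r) -addrA -lerBlDl mulr_sumr -sumrB.
rewrite (bigD1 h) //= (bigD1 k) 1?eq_sym //= addrA.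
rewrite -[leRHS]addr0 lerD //; last first.
  apply: sumr_le0 => g _.
  by have := tau_le g; have := S_ge0 g; nra.
have := tau_le h; have := tau_le k; nra.
Qed.
End Grid.

(** The coefficients are those of the base network: the same function serves for
    the original grid and for the grid of the two selected points. *)
Lemma effres_quadratic r : is_network r ->
  exists c0 ch ck chk : R, forall (s : edge G -> seq R) (a b : R),
    (forall g, is_grid (s g)) -> a \in grid (s h) -> b \in grid (s k) ->
    effres (subdivide_res r) (point_at s h a) (point_at s k b)
    = c0 + ch * a + ck * b + chk * (a * b)
      - (r h - effres r (src h) (tgt h)) * a ^+ 2
      - (r k - effres r (src k) (tgt k)) * b ^+ 2.
Proof.
move=> netB.
have [p0 P0] := unit_potential_exists netB (src h) (src k).
have [ph Ph] := unit_potential_exists netB (src h) (tgt h).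
have [pk Pk] := unit_potential_exists netB (src k) (tgt k).
rewrite (effresE netB Ph) (effresE netB Pk).
(* Coefficients of the potential drop of [effres_points], taken at the
   superposition of [p0], [ph] and [pk]. *)
exists (p0 (src h) - p0 (src k)).
exists (p0 (tgt h) - p0 (src h) - ph (src h) + ph (src k) + r h).
exists (pk (src h) + p0 (src k) - p0 (tgt k) - pk (src k) + r k).
exists (pk (tgt h) - pk (src h) + ph (tgt k) - ph (src k)).
move=> s a b s_grid ha kb.
rewrite (effres_points s_grid ha kb netB (superposed_split_current _ _ P0 Ph Pk)).
by ring.
Qed.
End TwoPoints.

(** * Averaging over the bracketing grid coordinates *)

Section Averaging.
Variable R : realType.

(** On the two values, [(X - t) ^ 2] agrees with the affine function
    [(a + b - 2 * t) * X + t ^ 2 - a * b] of [X], so the mean determines the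
    variance. *)
Lemma two_point_variance d (T : measurableType d) (P : probability T R)
    (X : {RV P >-> R}) (a b t eps : R) :
  (forall w, X w = a \/ X w = b) ->
  ('E_P[X] = t%:E)%E -> ('V_P[X] = eps%:E)%E -> eps = (b - t) * (t - a).
Proof.
move=> Xval EX VX.
have X1 : (X : T -> R) \in Lfun P 1.
  apply/Lfun1_integrable; apply: measurable_bounded_integrable => //.
    by rewrite -ge0_fin_numE // fin_num_measure.
  exists (`|a| + `|b|); split; first by rewrite num_real.
  move=> M ltM w _ /=; apply: le_trans (ltW ltM).
  by case: (Xval w) => ->; rewrite ?lerDl ?lerDr normr_ge0.
have c1 c : cst c \in Lfun P 1 by exact: Lfun_cst.
move: VX; rewrite /variance unlock EX /= => VX.
apply: EFin_inj; rewrite -VX.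
transitivity ('E_P[(a + b - 2 * t)%R \o* X \+ cst (t ^+ 2 - a * b)%R])%E.
  congr expectation; apply/funext => w /=.
  by rewrite !fctE /=; case: (Xval w) => ->; ring.
rewrite expectationD ?expectationZl ?expectation_cst ?EX //.
  by rewrite -EFinM -EFinD; congr EFin; ring.
exact: Lfun_scale.
Qed.

(** The weights [(b - t) / (b - a)] and [(t - a) / (b - a)] average [a] and [b]
    to [t] and their squares to [t ^ 2 + (b - t) * (t - a)]; averaging [q] over
    the four corners with product weights therefore reproduces the affine and
    mixed terms and shifts only the squares.  The proof clears the denominators. *)
Lemma quadratic_average (c0 ch ck chk A B D a b c d t u : R) :
  let q x y := c0 + ch * x + ck * y + chk * (x * y) - A * x ^+ 2 - B * y ^+ 2 in
  a < b -> c < d -> a <= t <= b -> c <= u <= d ->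
  q a c <= D -> q a d <= D -> q b c <= D -> q b d <= D ->
  q t u <= D + A * ((b - t) * (t - a)) + B * ((d - u) * (u - c)).
Proof.
move=> q ab cd /andP[a_t t_b] /andP[c_u u_d] qac qad qbc qbd.
have area : 0 < (b - a) * (d - c) by rewrite mulr_gt0 ?subr_gt0.
rewrite -subr_ge0 -(pmulr_rge0 _ area).
rewrite (_ : (b - a) * (d - c) * _ = (b - t) * (d - u) * (D - q a c)
  + (b - t) * (u - c) * (D - q a d) + (t - a) * (d - u) * (D - q b c)
  + (t - a) * (u - c) * (D - q b d)); last by rewrite /q; ring.
by rewrite !addr_ge0 ?mulr_ge0 ?subr_ge0.
Qed.

Lemma consecutive_grid (t : seq R) (a b : R) :
  is_grid t -> infix [:: a; b] (grid t) ->
  [/\ a < b, a \in grid t & b \in grid t].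
Proof.
move=> tP ab; have /= := infix_sorted ab tP; rewrite andbT => lt_ab.
by split=> //; rewrite (mem_infix ab) ?inE ?eqxx ?orbT.
Qed.

Lemma effres_le_max (G : multigraph) (s : edge G -> seq R) (r : edge G -> R)
    (g g' : edge G) (a a' : R) :
  a \in grid (s g) -> a' \in grid (s g') ->
  effres (subdivide_res r) (point_at s g a) (point_at s g' a')
  <= max_grid_effres s r.
Proof.
move=> sa sa'; rewrite /max_grid_effres.
apply: le_trans (le_bigmax_seq 0 g _ _ (mem_index_enum g) isT).
apply: le_trans (le_bigmax_seq 0 a _ _ sa isT).
apply: le_trans (le_bigmax_seq 0 g' _ _ (mem_index_enum g') isT).
exact: (le_bigmax_seq 0 a' _ _ sa' isT).
Qed.

Lemma two_points_grid (G : multigraph) (h k : edge G) (th tk : R) :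
  0 < th < 1 -> 0 < tk < 1 -> forall g, is_grid (two_points h k th tk g).
Proof.
move=> h01 k01 g; rewrite /two_points.
by case: ifP => _; [|case: ifP => _]; rewrite /is_grid /= ?ltr01 ?andbT.
Qed.

End Averaging.

(** * The resistance between the selected points *)

Theorem proposition2p5
  (R : realType) (G : multigraph) (r tau : edge G -> R) (beta : R)
  (netB : is_network r) (netK : is_network tau)
  (beta_gt0 : 0 < beta) (beta_le1 : beta <= 1)
  (tau_le : forall g : edge G, tau g <= beta * r g)
  (s : edge G -> seq R) (s_grid : forall g : edge G, is_grid (s g))
  (h k : edge G) (hk : h != k)
  (th tk : R) (th01 : 0 < th < 1) (tk01 : 0 < tk < 1)
  (ah bh ak bk : R)
  (consec_h : infix [:: ah; bh] (grid (s h))) (bracket_h : ah <= th <= bh)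
  (consec_k : infix [:: ak; bk] (grid (s k))) (bracket_k : ak <= tk <= bk)
  (d : measure_display) (T : measurableType d) (P : probability T R)
  (Xh Xk : {RV P >-> R})
  (Xh_val : forall w : T, Xh w = ah \/ Xh w = bh)
  (Xk_val : forall w : T, Xk w = ak \/ Xk w = bk)
  (Xh_mean : ('E_P[Xh] = th%:E)%E) (Xk_mean : ('E_P[Xk] = tk%:E)%E)
  (Xhk_indep : independent_RV Xh Xk)
  (eps_h eps_k : R)
  (eps_hE : ('V_P[Xh] = eps_h%:E)%E) (eps_kE : ('V_P[Xk] = eps_k%:E)%E) :
  let D := max_grid_effres s r in
  let rho (i : edge G) := effres r (src i) (tgt i) in
  let C (i : edge G) (t eps : R) :=
    (tau i - beta * r i) * t * (1 - t) + beta * (r i - rho i) * eps in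
  let pts := two_points h k th tk in
  let Rz := effres (subdivide_res (s := pts) tau)
                   (point_at pts h th) (point_at pts k tk) in
  Rz <= beta * D + C h th eps_h + C k tk eps_k
  /\ (C h th eps_h + C k tk eps_k <= (1 - beta) * D -> Rz <= D).
Proof.
move=> D rho C pts Rz.
have pts_grid := two_points_grid h k th01 tk01.
have pts_h : th \in grid (pts h) by rewrite /pts /two_points eqxx !inE eqxx orbT.
have pts_k : tk \in grid (pts k).
  by rewrite /pts /two_points eq_sym (negPf hk) eqxx !inE eqxx orbT.
have [lt_h ah_s bh_s] := consecutive_grid (s_grid h) consec_h.
have [lt_k ak_s bk_s] := consecutive_grid (s_grid k) consec_k.
have eps_hV := two_point_variance Xh_val Xh_mean eps_hE.
have eps_kV := two_point_variance Xk_val Xk_mean eps_kE.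
have RzB := effres_comparison hk pts_grid pts_h pts_k netB netK tau_le.
have [c0 [ch [ck [chk Q]]]] := effres_quadratic hk netB.
have QD a b : a \in grid (s h) -> b \in grid (s k) ->
    c0 + ch * a + ck * b + chk * (a * b) - (r h - rho h) * a ^+ 2
      - (r k - rho k) * b ^+ 2 <= D.
  by move=> sa sb; rewrite /rho -(Q s a b s_grid sa sb) effres_le_max.
have main : Rz <= beta * D + C h th eps_h + C k tk eps_k.
  (* The quadratic formula transfers from the grid [pts] to the grid [s]. *)
  apply: le_trans RzB _; rewrite (Q pts th tk pts_grid pts_h pts_k).
  have := quadratic_average lt_h lt_k bracket_h bracket_k
    (QD _ _ ah_s ak_s) (QD _ _ ah_s bk_s) (QD _ _ bh_s ak_s) (QD _ _ bh_s bk_s).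
  rewrite -eps_hV -eps_kV => /(ler_wpM2l (ltW beta_gt0)).
  rewrite /C /rho; lra.
split=> // small; apply: le_trans main _; lra.
Qed.
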